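(* Let $E$ be a real Banach space of dimension at least two and let $G\subsetneq E$ be a domain. Then $G$ is a distance $c$-John domain for some $c\ge 1$ if and only if $G$ satisfies the weak minimizing property.
   Context: A domain is an open connected set. The norm is written $|\cdot|$; $\delta G=\overline G\setminus G$ is the boundary of $G$, and $\delta_G(x)=\inf\{|x-y|:y\in\delta G\}$ for $x\in G$. A curve is a continuous map from a closed interval; it joins its endpoints. For $c\ge1$, a domain $G\subsetneq E$ is distance $c$-John if each pair of points $x_1,x_2\in G$ can be joined by a curve $\gamma$ in $G$ with $\min_{j=1,2}|x_j-x|\le c\,\delta_G(x)$ for all $x\in\gamma$. $G$ has the weak minimizing property if there exist a family $\Gamma$ of curves in $G$ and a constant $c$ such that for each $x_1,x_2\in G$ there is a curve $\gamma\in\Gamma$ joining $x_1$ and $x_2$ with $\min_{j=1,2}|x_j-y|\le c|x-y|$ for each $x\in\gamma$ and each $y\in\delta G$. *)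

(* Defs.v *)
From mathcomp Require Import all_boot all_order all_algebra.
From mathcomp Require Import all_classical all_reals all_analysis.
Set Implicit Arguments.
Unset Strict Implicit.
Unset Printing Implicit Defensive.
Import Order.TTheory GRing.Theory Num.Theory numFieldNormedType.Exports.
Local Open Scope classical_set_scope.
Local Open Scope ring_scope.

Section Defs.
Context {R : realType} {E : completeNormedModType R}.

(* The empty set is not excluded, as [connected set0] holds. *)
Definition domain (G : set E) : Prop := open G /\ connected G.

Definition boundary (G : set E) : set E := closure G `\` G.

(* [inf] is a genuine infimum only when [boundary G] is nonempty. This is so
   for a nonempty domain G <> setT, because E is connected. *)
Definition boundary_dist (G : set E) (x : E) : R :=
  inf [set `|x - y| | y in boundary G].

(* Only the values of [curve_fun] on [`[curve_lo, curve_hi]] matter; each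
   notion below is insensitive to the values outside. *)
Record curve : Type := Curve {
  curve_lo : R;
  curve_hi : R;
  curve_fun : R -> E;
  curve_lohi : curve_lo <= curve_hi;
  curve_cont : {within `[curve_lo, curve_hi], continuous curve_fun} }.

Definition curve_image (g : curve) : set E :=
  curve_fun g @` `[curve_lo g, curve_hi g].

Definition curve_in (g : curve) (G : set E) : Prop := curve_image g `<=` G.

(* Joining is symmetric in the two points: curves carry no orientation. *)
Definition joins (g : curve) (x1 x2 : E) : Prop :=
  (curve_fun g (curve_lo g) = x1 /\ curve_fun g (curve_hi g) = x2) \/
  (curve_fun g (curve_lo g) = x2 /\ curve_fun g (curve_hi g) = x1).

Definition distance_john (c : R) (G : set E) : Prop :=
  forall x1 x2 : E, G x1 -> G x2 ->
  exists g : curve, [/\ curve_in g G, joins g x1 x2 &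
    forall x, curve_image g x ->
      Num.min `|x1 - x| `|x2 - x| <= c * boundary_dist G x].

Definition weak_minimizing (G : set E) : Prop :=
  exists (Gamma : set curve) (c : R),
    (forall g, Gamma g -> curve_in g G) /\
    forall x1 x2 : E, G x1 -> G x2 ->
    exists g : curve, [/\ Gamma g, joins g x1 x2 &
      forall x y, curve_image g x -> boundary G y ->
        Num.min `|x1 - y| `|x2 - y| <= c * `|x - y|].

End Defs.

Arguments curve {R} E.

Definition dim_ge2 (R : realType) (E : completeNormedModType R) : Prop :=
  exists u v : E, forall a b : R, a *: u + b *: v = 0 -> a = 0 /\ b = 0.

(* Main.v *)
Require Import Defs.
From mathcomp Require Import all_boot all_order all_algebra.
From mathcomp Require Import all_classical all_reals all_analysis.
Import Order.TTheory GRing.Theory Num.Theory numFieldNormedType.Exports.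
Local Open Scope classical_set_scope.
Local Open Scope ring_scope.

(** Both conditions bound the distance from the nearer endpoint along the same
curves; they differ only in whether that distance is measured to a point [x] of
the curve or to a boundary point [y].  By the triangle inequality, exchanging
[x] and [y] changes the minimum of the two distances by at most [`|x - y|]
([min_dist_triangle]).  Hence, starting from a John curve, one adds
[boundary_dist G x <= `|x - y|] to pass from [c] to [c + 1]; conversely, the
weak minimizing bound gives
  [Num.min `|x1 - x| `|x2 - x| <= (c + 1) * `|x - y|]
for all boundary points [y], and one takes the infimum over [y].  This last
step needs the boundary to be nonempty ([boundary_neq0]), which comes from the
connectedness of the ambient space. *)

Section NormedSpace.
Context {R : realType} {E : completeNormedModType R}.
Implicit Types (G : set E) (x y : E).

Lemma min_dist_triangle (x1 x2 x y : E) :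
  Num.min `|x1 - y| `|x2 - y| <= Num.min `|x1 - x| `|x2 - x| + `|x - y|.
Proof.
rewrite -lerBlDr le_min; apply/andP; split; rewrite lerBlDr ge_min.
  by rewrite ler_distD.
by rewrite orbC ler_distD.
Qed.

(** If the boundary were empty, [G] would be closed as well as open, and so
would be its trace on the line through a point of [G] and a point outside [G];
but a line is connected. *)
Lemma boundary_neq0 G x : open G -> G x -> G `<` [set: E] -> boundary G !=set0.
Proof.
move=> oG Gx GT; apply/set0P/negP => /eqP bG0.
have clG : closed G.
  move=> y cGy; apply: contrapT => nGy.
  have : boundary G y by [].
  by rewrite bG0.
have [z [_ nGz]] := nonsubset GT.2.
pose f (t : R) : E := x + t *: (z - x).
have cf : continuous f.
  move=> t; apply: cvgD; first exact: cvg_cst.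
  by apply: cvgZr_tmp; exact: cvg_id.
have [oP cP] : clopen (f @^-1` G) by exact: preimage_clopen.
have cR : connected [set: R] by apply/connected_intervalP.
have PT : f @^-1` G = [set: R].
  apply: cR.
  - by exists 0; rewrite /f /= scale0r addr0.
  - by exists (f @^-1` G) => //; rewrite setTI.
  - by exists (f @^-1` G) => //; rewrite setTI.
have : (f @^-1` G) 1 by rewrite PT.
by rewrite /f /= scale1r addrC subrK.
Qed.

Lemma boundary_dist_le G x y : boundary G y -> boundary_dist G x <= `|x - y|.
Proof.
move=> Gy; apply: ge_inf; last by exists y.
by exists 0 => _ [w _ <-].
Qed.

Lemma le_boundary_dist G x (r : R) : boundary G !=set0 ->
  (forall y, boundary G y -> r <= `|x - y|) -> r <= boundary_dist G x.
Proof.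
move=> [y Gy] lbr; apply: lb_le_inf; first by exists `|x - y|, y.
by move=> _ [w Gw <-]; exact: lbr.
Qed.

End NormedSpace.

Theorem theorem1p12 (R : realType) (E : completeNormedModType R)
    (hE : dim_ge2 E) (G : set E) (hG : domain G) (hGE : G `<` [set: E]) :
  (exists2 c : R, 1 <= c & distance_john c G) <-> weak_minimizing G.
Proof.
split=> [[c c1 Jc]|[Gamma [c [GammaG WM]]]].
  exists [set g | curve_in g G], (c + 1); split=> // x1 x2 Gx1 Gx2.
  have [g [gG gx gJ]] := Jc x1 x2 Gx1 Gx2.
  exists g; split=> // x y gx' Gy.
  apply: le_trans (min_dist_triangle x1 x2 x y) _.
  rewrite mulrDl mul1r lerD2r.
  apply: le_trans (gJ x gx') _.
  by rewrite ler_pM2l ?(lt_le_trans ltr01)// boundary_dist_le.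
(* The constant of the weak minimizing property has no prescribed sign, while
   a John constant must be at least 1. *)
pose C := Num.max c 0 + 1.
have C1 : 1 <= C by rewrite lerDr le_max lexx orbT.
have C0 : 0 < C by exact: lt_le_trans ltr01 C1.
exists C => // x1 x2 Gx1 Gx2.
have [g [Gammag gx gWM]] := WM x1 x2 Gx1 Gx2.
exists g; split=> //; first exact: GammaG.
move=> x gx'.
rewrite -ler_pdivrMl//; apply: le_boundary_dist => [|y Gy].
  exact: boundary_neq0 hG.1 Gx1 hGE.
rewrite ler_pdivrMl//.
apply: le_trans (min_dist_triangle x1 x2 y x) _.
rewrite (distrC y x) mulrDl mul1r lerD2r.
apply: le_trans (gWM x y gx' Gy) _.
by rewrite ler_wpM2r// le_max lexx.
Qed.
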